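(* Let $K$ be a field. For every integer $n\geq 1$, let $S_n=K[x_1,\ldots,x_n,y]$ and let $I_n=(x_1y,x_2y,\ldots,x_ny)\subset S_n$. Then $$\operatorname{hdepth}(S_n/I_n)\geq \left\lceil \frac{n}{2} \right\rceil + \left\lfloor \sqrt{n} \right\rfloor - 2.$$
   Context: Let $S$ be a polynomial ring in finitely many variables over a field $K$, with the standard grading (each variable has degree $1$), and let $M$ be a finitely generated graded $S$-module. The Hilbert depth of $M$, denoted $\operatorname{hdepth}(M)$, is the maximal depth of a finitely generated graded $S$-module $N$ with the same Hilbert series as $M$. The ideal $I_n$ is the edge ideal of the star graph with vertex set $\{x_1,\ldots,x_n,y\}$ and edges $\{x_i,y\}$, $1\leq i\leq n$. $\lceil\cdot\rceil$ and $\lfloor\cdot\rfloor$ denote the ceiling and floor functions. *)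

(* Defs.v *)
From HB Require Import structures.
From mathcomp Require Import all_boot all_order all_algebra all_field.
From mathcomp Require Import boolp mpoly.

Set Implicit Arguments.
Unset Strict Implicit.
Unset Printing Implicit Defensive.

Import GRing.Theory Num.Theory.
Local Open Scope ring_scope.
Local Open Scope quotient_scope.

(* The action of K on an S-module is the one induced by K -> S, c |-> c%:MP.  *)
Record gradedModule (K : fieldType) (m : nat) := GradedModule {
  gmod :> lmodType {mpoly K[m]};
  gpart : int -> gmod -> Prop;
  gpart0 : forall d, gpart d 0;
  gpartD : forall d u v, gpart d u -> gpart d v -> gpart d (u + v);
  gpartZ : forall (e : nat) d (p : {mpoly K[m]}) u,
    p \is e.-homog -> gpart d u -> gpart (e%:Z + d) (p *: u);
  gpart_sum : forall u, exists (s : seq int) (c : int -> gmod),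
    [/\ uniq s, (forall d, gpart d (c d)) & u = \sum_(d <- s) c d];
  gpart_free : forall (s : seq int) (c : int -> gmod),
    uniq s -> (forall d, gpart d (c d)) -> \sum_(d <- s) c d = 0 ->
    forall d, d \in s -> c d = 0
}.

Section Depth.
Variables (K : fieldType) (m : nat).
Local Notation S := {mpoly K[m]}.

(* u belongs to the submodule (s)N, where (s) is the ideal generated by s.    *)
Definition in_idealM (N : lmodType S) (s : seq S) (u : N) : Prop :=
  exists v : 'I_(size s) -> N, u = \sum_(i < size s) s`_i *: v i.

Definition in_ideal (s : seq S) (p : S) : Prop := @in_idealM S^o s p.

Definition in_maximal_ideal (p : S) : Prop :=
  in_ideal [seq 'X_i | i <- enum 'I_m] p.

Definition regular_seq (N : lmodType S) (s : seq S) : Prop :=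
  [/\ forall p, p \in s -> in_maximal_ideal p,
      forall i, (i < size s)%N -> forall u : N,
        in_idealM (take i s) (s`_i *: u) -> in_idealM (take i s) u
    & exists u : N, ~ in_idealM s u].

Definition is_depth (N : lmodType S) (r : nat) : Prop :=
  (exists2 s, regular_seq N s & size s = r) /\
  (forall s, regular_seq N s -> (size s <= r)%N).

Definition finitely_generated (N : lmodType S) : Prop :=
  exists (k : nat) (g : 'I_k -> N),
    forall u, exists a : 'I_k -> S, u = \sum_i a i *: g i.

Definition has_dim (N : gradedModule K m) (d : int) (k : nat) : Prop :=
  exists b : 'I_k -> N,
    [/\ forall i, gpart d (b i),
        forall u : N, gpart d u ->
          exists c : 'I_k -> K, u = \sum_i (c i)%:MP *: b i
      & forall c : 'I_k -> K, \sum_i (c i)%:MP *: b i = 0 ->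
          forall i, c i = 0].

(* H d is the coefficient of t ^ d in the Hilbert series of N.                *)
Definition is_hilbert_series (N : gradedModule K m) (H : int -> nat) : Prop :=
  forall d, has_dim N d (H d).

Definition same_hilbert_series (M N : gradedModule K m) : Prop :=
  exists H, is_hilbert_series M H /\ is_hilbert_series N H.

Definition hdepth_candidate (M N : gradedModule K m) : Prop :=
  finitely_generated N /\ same_hilbert_series M N.

Definition is_hdepth (M : gradedModule K m) (h : nat) : Prop :=
  (exists2 N : gradedModule K m, hdepth_candidate M N & is_depth N h) /\
  (forall (N : gradedModule K m) k,
     hdepth_candidate M N -> is_depth N k -> (k <= h)%N).

End Depth.

Section CyclicModule.
Variables (K : fieldType) (m : nat) (s : seq {mpoly K[m]}).
Local Notation S := {mpoly K[m]}.

Definition ideal : {pred S} := fun p => `[< in_ideal s p >].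

Lemma idealP p : reflect (in_ideal s p) (p \in ideal).
Proof. exact: asboolP. Qed.

Lemma ideal_zmod_closed : zmod_closed ideal.
Proof.
split=> [|p q /idealP[v ->] /idealP[w ->]]; apply/idealP.
  by exists (fun _ => 0); rewrite big1 // => i _; rewrite scaler0.
exists (fun i => v i - w i); rewrite -sumrB.
by apply: eq_bigr => i _; rewrite scalerBr.
Qed.

HB.instance Definition _ := GRing.isZmodClosed.Build S ideal ideal_zmod_closed.

Lemma idealMl a p : p \in ideal -> a * p \in ideal.
Proof.
case/idealP=> v ->; apply/idealP; exists (fun i => a * v i).
by rewrite mulr_sumr; apply: eq_bigr => i _; rewrite mulrCA.
Qed.

(* The S-module S / (s).                                                      *)
Definition cyclic_module : Type := Quotient.quot ideal.

HB.instance Definition _ := GRing.Zmodule.on cyclic_module.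

Definition cyclic_pi (p : S) : cyclic_module := \pi_(Quotient.quot ideal) p.

Lemma cyclic_piB : {morph cyclic_pi : p q / p - q}.
Proof. exact: (raddfB (\pi_(Quotient.quot ideal))). Qed.

HB.instance Definition _ :=
  GRing.isZmodMorphism.Build S cyclic_module cyclic_pi cyclic_piB.

Lemma cyclic_pi_eq p q : cyclic_pi p = cyclic_pi q <-> p - q \in ideal.
Proof. by rewrite Quotient.idealrBE; split=> /eqP. Qed.

Lemma cyclic_pi_eq0 p : cyclic_pi p = 0 <-> p \in ideal.
Proof. by have := cyclic_pi_eq p 0; rewrite raddf0 subr0. Qed.

Lemma cyclic_piP (u : cyclic_module) : exists p, u = cyclic_pi p.
Proof. by exists (repr u); rewrite /cyclic_pi reprK. Qed.

Definition cyclic_scale (a : S) (u : cyclic_module) : cyclic_module :=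
  cyclic_pi (a * repr u).

Lemma cyclic_scale_pi a p : cyclic_scale a (cyclic_pi p) = cyclic_pi (a * p).
Proof.
apply/cyclic_pi_eq; rewrite -mulrBr; apply: idealMl.
by apply/cyclic_pi_eq; rewrite {1}/cyclic_pi reprK.
Qed.

Lemma cyclic_scaleA a b u :
  cyclic_scale a (cyclic_scale b u) = cyclic_scale (a * b) u.
Proof. by case: (cyclic_piP u) => p ->; rewrite !cyclic_scale_pi mulrA. Qed.

Lemma cyclic_scale1 : left_id 1 cyclic_scale.
Proof. by move=> u; case: (cyclic_piP u) => p ->; rewrite cyclic_scale_pi mul1r. Qed.

Lemma cyclic_scaleDr : right_distributive cyclic_scale +%R.
Proof.
move=> a u v; case: (cyclic_piP u) (cyclic_piP v) => p -> [q ->].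
by rewrite -raddfD !cyclic_scale_pi mulrDr raddfD.
Qed.

Lemma cyclic_scaleDl u : {morph cyclic_scale^~ u : a b / a + b}.
Proof.
by move=> a b; case: (cyclic_piP u) => p ->; rewrite !cyclic_scale_pi mulrDl raddfD.
Qed.

HB.instance Definition _ := GRing.Zmodule_isLmodule.Build S cyclic_module
  cyclic_scaleA cyclic_scale1 cyclic_scaleDr cyclic_scaleDl.

Lemma cyclic_piZ a p : a *: cyclic_pi p = cyclic_pi (a * p).
Proof. exact: cyclic_scale_pi. Qed.

Lemma cyclic_module_fg : finitely_generated cyclic_module.
Proof.
exists 1%N, (fun _ => cyclic_pi 1) => u; case: (cyclic_piP u) => p ->.
by exists (fun _ => p); rewrite big_ord1 cyclic_piZ mulr1.
Qed.

Definition cyclic_part (d : int) (u : cyclic_module) : Prop :=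
  if d is Posz e then exists2 p, p \is e.-homog & u = cyclic_pi p else u = 0.

Hypothesis s_homog : forall p, p \in s -> exists e : nat, p \is e.-homog.

Lemma pihomogM (e d : nat) (p q : S) : p \is e.-homog ->
  pihomog mdeg d (p * q) =
  p * (if (e <= d)%N then pihomog mdeg (d - e) q else 0).
Proof.
move=> hp; rewrite {1}(pihomog_partitionE (leqnn (mmeasure mdeg q))).
have hpq k : p * pihomog mdeg k q \is (e + k).-homog.
  by apply: dhomogM => //; apply: pihomogP.
rewrite mulr_sumr raddf_sum /=.
case: leqP => [le_ed|lt_de]; last first.
  rewrite mulr0 big1 // => k _; apply: (pihomog_ne0 _ (hpq k)).
  by rewrite neq_ltn orbC (leq_trans lt_de) ?leq_addr.
rewrite [in RHS](pihomog_partitionE (leqnn (mmeasure mdeg q))).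
rewrite raddf_sum mulr_sumr /=; apply: eq_bigr => k _.
have hk := pihomogP mdeg k q.
have [eq_k|ne_k] := eqVneq (k : nat) (d - e)%N.
  by rewrite -eq_k pihomog_id pihomog_dE //; have := hpq k; rewrite eq_k subnKC.
rewrite (pihomog_ne0 ne_k hk) mulr0; apply: (pihomog_ne0 _ (hpq k)).
by apply: contra_neq ne_k => <-; rewrite addKn.
Qed.

Lemma ideal_pihomog d p : p \in ideal -> pihomog mdeg d p \in ideal.
Proof.
case/idealP=> v ->; rewrite raddf_sum /=; apply: rpred_sum => i _.
have s_i : s`_i \in s by rewrite mem_nth.
have [e he] := s_homog s_i.
rewrite (pihomogM _ _ he) mulrC; apply: idealMl; apply/idealP.
exists (fun j => (j == i)%:R); rewrite (bigD1 i) //= big1 ?addr0.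
  by rewrite eqxx /GRing.scale /= mulr1.
by move=> j /negbTE ->; rewrite /GRing.scale /= mulr0.
Qed.

Lemma cyclic_partE d u : cyclic_part d u ->
  exists2 p : S, u = cyclic_pi p &
    forall e : nat, pihomog mdeg e p = if d == e%:Z then p else 0.
Proof.
case: d => [d|d] /=; last first.
  by move=> ->; exists 0 => [|e]; rewrite ?raddf0.
case=> p hp ->; exists p => // e; rewrite eqz_nat.
case: eqVneq => [<-|ne]; first by rewrite pihomog_dE.
exact: pihomog_ne0 ne hp.
Qed.

Lemma cyclic_part0 d : cyclic_part d 0.
Proof. by case: d => [d|d] //=; exists 0; rewrite ?rpred0 ?raddf0. Qed.

Lemma cyclic_partD d u v :
  cyclic_part d u -> cyclic_part d v -> cyclic_part d (u + v).
Proof.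
case: d => [d|d] /=; last by move=> -> ->; rewrite addr0.
by case=> p hp -> [q hq ->]; exists (p + q); rewrite ?rpredD ?raddfD.
Qed.

Lemma cyclic_partZ (e : nat) d (p : S) u :
  p \is e.-homog -> cyclic_part d u -> cyclic_part (e%:Z + d) (p *: u).
Proof.
move=> hp; case: d => [d|d] /=.
  by case=> q hq ->; exists (p * q); rewrite ?dhomogM ?cyclic_piZ.
by move=> ->; rewrite scaler0; apply: cyclic_part0.
Qed.

Lemma cyclic_part_sum u : exists (r : seq int) (c : int -> cyclic_module),
  [/\ uniq r, (forall d, cyclic_part d (c d)) & u = \sum_(d <- r) c d].
Proof.
case: (cyclic_piP u) => p ->.
exists [seq Posz k | k <- iota 0 (mmeasure mdeg p)].
exists (fun d => if d is Posz e then cyclic_pi (pihomog mdeg e p) else 0).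
split; first by rewrite map_inj_uniq ?iota_uniq // => i j [].
  by case=> e //=; exists (pihomog mdeg e p) => //; apply: pihomogP.
rewrite big_map -[X in iota _ X]subn0 big_mkord -raddf_sum /=.
by rewrite -pihomog_partitionE.
Qed.

Lemma cyclic_part_free (r : seq int) (c : int -> cyclic_module) :
  uniq r -> (forall d, cyclic_part d (c d)) -> \sum_(d <- r) c d = 0 ->
  forall d, d \in r -> c d = 0.
Proof.
move=> r_uniq c_part sum0 d d_r.
case: d d_r => [e|e] d_r; last exact: (c_part (Negz e)).
have c_pi d1 : exists p : S, c d1 = cyclic_pi p /\
    forall k : nat, pihomog mdeg k p = if d1 == k%:Z then p else 0.
  by have [p cp hp] := cyclic_partE (c_part d1); exists p.
have [f fP] := choice c_pi.
have : \sum_(d <- r) f d \in ideal.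
  apply/cyclic_pi_eq0; rewrite raddf_sum -[RHS]sum0.
  by apply: eq_bigr => d _; case: (fP d).
move/(@ideal_pihomog e); rewrite raddf_sum /= (bigD1_seq (Posz e)) //=.
rewrite big1 => [|d ne_d]; last by case: (fP d) => _ ->; rewrite (negbTE ne_d).
case: (fP e) => -> ->; rewrite eqxx addr0 => he.
exact/cyclic_pi_eq0.
Qed.

Definition graded_cyclic_module : gradedModule K m :=
  GradedModule cyclic_part0 cyclic_partD cyclic_partZ
    cyclic_part_sum cyclic_part_free.

End CyclicModule.

Section Star.
Variables (K : fieldType) (n : nat).

(* In {mpoly K[n.+1]}, the variables of index i < n are x_1, ..., x_n and the
   last one is y.                                                             *)
Definition star_edges : seq {mpoly K[n.+1]} :=
  [seq 'X_(widen_ord (leqnSn n) i) * 'X_ord_max | i <- enum 'I_n].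

Lemma star_edges_homog p : p \in star_edges -> exists e : nat, p \is e.-homog.
Proof.
by case/mapP=> i _ ->; exists (1 + 1)%N; apply: dhomogM; rewrite dhomogX; apply/eqP/mdeg1.
Qed.

(* S_n / I_n with the standard grading.                                       *)
Definition star_module : gradedModule K n.+1 :=
  graded_cyclic_module star_edges_homog.

End Star.

(* Main.v *)
From Stdlib Require Import NArith.
Require Import Defs.
From mathcomp Require Import all_boot all_order all_algebra all_field.
From mathcomp Require Import boolp mpoly zify ring.

(** The monomials outside I_n are the monomials in x_1, ..., x_n and the
    positive powers of y, so the Hilbert series of S_n / I_n is
    H = 1/(1-t)^n + t/(1-t).  Put r = ceil(n/2) + floor(sqrt n) - 2.  When H is
    a finite sum of series t^e/(1-t)^j with r <= j <= n, it is also the Hilbert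
    series of the direct sum N of the modules K[j variables] shifted by e; each
    of these is the quotient of S_n by the remaining variables, so the first r
    variables of S_n form a regular sequence on N, and N has depth at least r
    ([has_dim_sum], [regular_seq_sum]).  For r = 0 the module S_n / I_n itself
    serves.

    Such an expression of H exists as soon as
    (1-t)^r H = 1/(1-t)^(n-r) + t (1-t)^(r-1) has nonnegative coefficients
    ([decomposable_star]): from degree r+1 on, the second summand vanishes and
    the first one is a tail of 1/(1-t)^(n-r), which splits into shifted powers
    of 1/(1-t) by induction on the exponent; the finitely many coefficients
    below are treated one by one.  Write a = n-r-1 and g = r-1-a.  The
    coefficients are nonnegative when C(a+g, j) <= C(a+j+1, j+1) for all odd j
    ([binom_odd_le]).  With k = g-j-1, the quotient of the two sides is
    (a+1)/(j+1) times a product of k factors, each of which is at least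
    (a/(a+1))^j.  The choice of r gives (g+1)^2 <= 8a, hence jk <= 2a, so that
    the product is at least 1/9.  This settles the large g; the quotient grows
    with a, so for each of the remaining g only the least a has to be examined,
    which is a finite computation.

    The Hilbert depth is a maximum, and its existence requires a bound on the
    depths of all competing modules.  If f_1, ..., f_k is a regular sequence on
    a module N and u is outside (f_1, ..., f_k)N, no nonzero polynomial expression
    in the f_i with coefficients in K kills u ([indep_mod_powers]); comparing
    the number of monomials in the f_i with the dimension of a space of
    polynomials of bounded degree shows that k is at most the number of
    variables ([regular_seq_size_le]). *)

Set Implicit Arguments.
Unset Strict Implicit.
Unset Printing Implicit Defensive.

Import GRing.Theory Num.Theory.

(** * A binomial inequality *)

Lemma leq_prod_cross (a a' j k : nat) : a <= a' ->
  (\prod_(i < k) (a' + j + i)) * (\prod_(i < k) (a + i)) <=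
  (\prod_(i < k) (a + j + i)) * (\prod_(i < k) (a' + i)).
Proof.
move=> le_aa'; rewrite -!big_split /=; apply: leq_prod => i _.
have : j * a <= j * a' by rewrite leq_mul2l le_aa' orbT.
by nia.
Qed.

(** The inequality C(a+j+k+1, j) <= C(a+j+1, j+1) once both sides are divided
    by (a+j+1)! and the denominators are cleared ([cancelled_binom_leP]). *)
Definition cancelled_binom_le (a j k : nat) : bool :=
  j.+1 * \prod_(i < k) (a + 2 + j + i) <= a.+1 * \prod_(i < k) (a + 2 + i).

(** Each factor (a+2+i)/(a+2+j+i), as well as a+1, increases with a. *)
Lemma cancelled_binom_le_mono a a' j k : a <= a' ->
  cancelled_binom_le a j k -> cancelled_binom_le a' j k.
Proof.
rewrite /cancelled_binom_le => le_aa' ok_a.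
have le2 : a + 2 <= a' + 2 by rewrite leq_add2r.
have cross := leq_prod_cross j k le2.
have pos : 0 < \prod_(i < k) (a + 2 + i).
  by apply: prodn_gt0 => i; rewrite addn2.
rewrite -(leq_pmul2r pos) -mulnA.
apply: leq_trans (leq_mul (leqnn j.+1) cross) _.
rewrite mulnA.
apply: leq_trans (leq_mul ok_a (leqnn _)) _.
rewrite -!mulnA [X in _ * X <= _]mulnC.
by apply: leq_mul.
Qed.

Lemma rising_fact a k : (\prod_(i < k) (a.+1 + i)) * a`! = (a + k)`!.
Proof.
elim: k => [|k IH]; first by rewrite big_ord0 mul1n addn0.
by rewrite big_ord_recr /= mulnAC IH addnS factS mulnC addSn.
Qed.

Lemma cancelled_binom_leP a j k : cancelled_binom_le a j k ->
  'C(a + (j + k).+1, j) <= 'C(a + j.+1, j.+1).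
Proof.
rewrite /cancelled_binom_le => ok.
have e1 : 'C(a + (j + k).+1, j) * (j`! * (a + k.+1)`!) = (a + (j + k).+1)`!.
  have -> : a + k.+1 = a + (j + k).+1 - j by lia.
  by apply: bin_fact; lia.
have e2 : 'C(a + j.+1, j.+1) * (j.+1`! * a`!) = (a + j.+1)`!.
  have {2}-> : a = a + j.+1 - j.+1 by lia.
  by apply: bin_fact; lia.
have p1 := rising_fact (a + j.+1) k.
have p2 := rising_fact a.+1 k.
have eA : \prod_(i < k) ((a + j.+1).+1 + i) = \prod_(i < k) (a + 2 + j + i).
  by apply: eq_bigr => i _; lia.
have eB : \prod_(i < k) (a.+2 + i) = \prod_(i < k) (a + 2 + i).
  by apply: eq_bigr => i _; lia.
rewrite eA in p1; rewrite eB in p2; move: p1 p2 ok => {eA eB}.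
set A := \prod_(_ < k) _; set B := \prod_(_ < k) _ => p1 p2 ok.
have f2 : 0 < (a + k.+1)`! * (j.+1`! * a`!) by rewrite !muln_gt0 !fact_gt0.
rewrite -(leq_pmul2r f2).
have -> : 'C(a + (j + k).+1, j) * ((a + k.+1)`! * (j.+1`! * a`!)) =
  (j.+1 * A) * (a + j.+1)`! * a`!.
  rewrite factS.
  transitivity (('C(a + (j + k).+1, j) * (j`! * (a + k.+1)`!)) * j.+1 * a`!).
    by lia.
  rewrite e1 -mulnA -mulnA -mulnA; have -> : a + (j + k).+1 = a + j.+1 + k by lia.
  rewrite -p1; lia.
have -> : 'C(a + j.+1, j.+1) * ((a + k.+1)`! * (j.+1`! * a`!)) =
  (a.+1 * B) * (a + j.+1)`! * a`!.
  rewrite mulnCA e2; have -> : a + k.+1 = a.+1 + k by lia.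
  rewrite -p2 factS; lia.
by rewrite !leq_mul2r ok !orbT.
Qed.

(** The rising factorials are computed in binary, which makes the finite check
    [ratio_check_70] feasible. *)
Fixpoint rising_N (s : N) (k : nat) : N :=
  if k is k'.+1 then (rising_N s k' * (s + N.of_nat k'))%num else 1%num.

Lemma rising_NE (s : N) k : N.to_nat (rising_N s k) = \prod_(i < k) (N.to_nat s + i).
Proof.
elim: k => [|k IH]; first by rewrite big_ord0.
by rewrite big_ord_recr /= -IH; lia.
Qed.

(** The number (g.+1 * g.+1 + 7) %/ 8 is the least a with (g+1)^2 <= 8a. *)
Definition ratio_check_N (g j : nat) : bool :=
  let a := N.of_nat ((g.+1 * g.+1 + 7) %/ 8) in
  let k := g - j.+1 in
  N.leb (N.of_nat j.+1 * rising_N (a + 2 + N.of_nat j) k)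
        ((a + 1) * rising_N (a + 2) k).

Lemma ratio_check_NP g j : ratio_check_N g j ->
  cancelled_binom_le ((g.+1 * g.+1 + 7) %/ 8) j (g - j.+1).
Proof.
rewrite /ratio_check_N /cancelled_binom_le; set a := _ %/ 8 => /N.leb_le h.
have h1 := rising_NE (N.of_nat a + 2 + N.of_nat j) (g - j.+1).
have h2 := rising_NE (N.of_nat a + 2) (g - j.+1).
have e1 : N.to_nat (N.of_nat a + 2 + N.of_nat j) = a + 2 + j by lia.
have e2 : N.to_nat (N.of_nat a + 2) = a + 2 by lia.
rewrite e1 in h1; rewrite e2 in h2; rewrite -h1 -h2; lia.
Qed.

Lemma ratio_check_70 :
  all (fun g => all (fun j => odd j ==> ratio_check_N g j) (iota 0 g)) (iota 0 71).
Proof. by vm_compute. Qed.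

Lemma leq_bernoulli x n : x ^ n.+1 + n.+1 * x ^ n <= x.+1 ^ n.+1.
Proof.
elim: n => [|n IH]; first by rewrite !expn1 expn0; lia.
rewrite [x.+1 ^ _]expnS; apply: leq_trans (leq_mul (leqnn x.+1) IH).
rewrite (expnS x n.+1) (expnS x n); nia.
Qed.

(** The sequence (1+1/a)^(a+1) decreases, by the Bernoulli inequality applied
    to 1 + 1/(a(a+2)) = (a+1)^2/(a(a+2)), and it is below 3 from a = 5 on. *)
Lemma expn_succ_le a : 4 < a -> a.+1 ^ a.+1 <= 3 * a ^ a.+1.
Proof.
elim: a => // a IH; rewrite ltnS leq_eqVlt => /orP[/eqP <-|lt4a].
  suff : (N.leb (6 ^ 6) (3 * 5 ^ 6))%num by move=> /N.leb_le; lia.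
  by vm_compute.
have {IH} h := IH lt4a.
have b := leq_bernoulli (a * a.+2) a.+1.
have e : (a * a.+2).+1 = a.+1 ^ 2 by rewrite -mulnn; lia.
rewrite e -expnM expnMn in b.
have pos : 0 < a ^ a.+2 by rewrite expn_gt0; lia.
rewrite -(leq_pmul2r pos).
have : a * (a.+2 ^ a.+2 * a ^ a.+2) <= a * (3 * a.+1 ^ a.+2 * a ^ a.+2).
  have step : a.+1 * ((a * a.+2) ^ a.+2) <= a * a.+1 ^ (2 * a.+2).
    rewrite -expnMn in b.
    have := leq_mul (leqnn a) b; rewrite (expnS (a * a.+2)); nia.
  have : a.+1 * (a * (a.+2 ^ a.+2 * a ^ a.+2)) <= a.+1 * (a * (3 * a.+1 ^ a.+2 * a ^ a.+2)).
    apply: (@leq_trans (a * (a * a.+1 ^ (2 * a.+2)))).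
      by rewrite expnMn in step; nia.
    have -> : 2 * a.+2 = a.+1 + a.+2 + 1 by lia.
    rewrite !expnD expn1 (expnS a a.+1).
    have := leq_mul h (leqnn (a * a * a.+1 ^ a.+2 * a.+1)); lia.
  by rewrite leq_pmul2l.
by rewrite leq_pmul2l //; lia.
Qed.

Lemma expn_succ_le9 a e : 4 < a -> e <= 2 * a -> a.+1 ^ e <= 9 * a ^ e.
Proof.
move=> a4 le_e.
have pos : 0 < a ^ (2 * a.+1 - e) by rewrite expn_gt0; lia.
rewrite -(leq_pmul2r pos) -mulnA -expnD subnKC; last by lia.
apply: (@leq_trans (a.+1 ^ (2 * a.+1))).
  have {2}-> : 2 * a.+1 = e + (2 * a.+1 - e) by lia.
  by rewrite expnD leq_mul2l leq_exp2r ?leqnSn ?orbT //; lia.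
have h := expn_succ_le a4.
by rewrite mulnC !expnM; have := leq_mul h h; rewrite !mulnn; lia.
Qed.

(** By the Bernoulli inequality (a+2+j+i)/(a+2+i) <= 1 + j/a <= (1+1/a)^j, so
    the quotient of the two products is at most (1+1/a)^(jk) <= 9. *)
Lemma cancelled_binom_le_large a j k : 4 < a -> j * k <= 2 * a -> 9 * j.+1 <= a.+1 ->
  cancelled_binom_le a j k.
Proof.
move=> a4 le_jk le_j; rewrite /cancelled_binom_le.
have pos : 0 < a ^ (j * k) by rewrite expn_gt0; lia.
have le_prod : \prod_(i < k) (a + 2 + j + i) * a ^ (j * k) <=
    \prod_(i < k) (a + 2 + i) * a.+1 ^ (j * k).
  have pw x : x ^ (j * k) = \prod_(i < k) x ^ j.
    by rewrite expnM prod_nat_const card_ord.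
  rewrite !pw -!big_split /=; apply: leq_prod => i _.
  case: j {le_jk le_j pos pw} => [|j]; first by rewrite addn0.
  have := leq_mul (leqnn (a + 2 + i)) (leq_bernoulli a j).
  rewrite (expnS a j); nia.
have le9 := expn_succ_le9 a4 le_jk.
have {le_prod} le_prod := leq_trans le_prod (leq_mul (leqnn _) le9).
rewrite mulnCA mulnA leq_pmul2r // in le_prod.
apply: leq_trans (leq_mul (leqnn _) le_prod) _.
rewrite mulnA leq_mul //; lia.
Qed.

(** For g <= j the left-hand side is at most C(a+j, j).  Otherwise the finite
    check covers g <= 70, and for larger g the bound (g+1)^2 <= 8a makes a large
    enough for [cancelled_binom_le_large]. *)
Lemma binom_odd_le a g j : g.+1 * g.+1 <= 8 * a -> odd j ->
  'C(a + g, j) <= 'C(a + j.+1, j.+1).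
Proof.
move=> le_ga odd_j; case: (ltnP j g) => [lt_jg|le_gj].
  have -> : g = (j + (g - j.+1)).+1 by lia.
  apply: cancelled_binom_leP; case: (leqP g 70) => [le_g|lt_g].
    have a_min : (g.+1 * g.+1 + 7) %/ 8 <= a by lia.
    apply: cancelled_binom_le_mono a_min _; apply: ratio_check_NP.
    move/allP/(_ g): ratio_check_70; rewrite mem_iota /= add0n ltnS => /(_ le_g).
    move/allP/(_ j); rewrite mem_iota /= add0n => /(_ lt_jg).
    by rewrite odd_j.
  have sq : 4 * (j * (g - j.+1)) <= g.+1 * g.+1.
    (* j and g-j-1 add up to g-1, so four times their product is at most
       the square of g-1 *)
    have [+ _] := nat_AGM2 j (g - j.+1); rewrite -mulnn => /leq_trans; apply.
    by apply: leq_mul; lia.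
  (* 9(j+1) <= 9g, and 72g <= (g+1)^2 <= 8a because 70 < g *)
  have : 72 * g <= g.+1 * g.+1 by nia.
  by move=> h; apply: cancelled_binom_le_large; lia.
apply: (@leq_trans 'C(a + j, j)).
  by apply: leq_bin2l; lia.
by rewrite addnS binS leq_addl.
Qed.

(** * Sums of shifted powers of 1/(1-t) *)

Local Open Scope ring_scope.

(** A power series is represented by its sequence of coefficients; [psum] is
    then the multiplication by 1/(1-t), and [delta e] is t^e. *)
Definition psum (f : nat -> int) (d : nat) : int := \sum_(i < d.+1) f i.

Definition delta (e d : nat) : int := (d == e)%:R.

Lemma psum0 f : psum f 0 = f 0%N.
Proof. by rewrite /psum big_ord1. Qed.

Lemma psumS f d : psum f d.+1 = psum f d + f d.+1.
Proof. by rewrite /psum big_ord_recr. Qed.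

Lemma eq_psum f g : f =1 g -> psum f =1 psum g.
Proof. by move=> eq_fg d; apply: eq_bigr. Qed.

Lemma eq_iter_psum k f g : f =1 g -> iter k psum f =1 iter k psum g.
Proof. by move=> eq_fg; elim: k => //= k IH; apply: eq_psum. Qed.

Lemma psum_sum (I : Type) (s : seq I) (F : I -> nat -> int) d :
  psum (fun i => \sum_(x <- s) F x i) d = \sum_(x <- s) psum (F x) d.
Proof. exact: exchange_big. Qed.

Lemma iter_psumD k f g d :
  iter k psum (fun i => f i + g i) d = iter k psum f d + iter k psum g d.
Proof.
elim: k d => //= k IH d; rewrite (eq_psum IH) /psum; exact: big_split.
Qed.

Lemma psum_delta e d : psum (delta e) d = (e <= d)%:R.
Proof.
elim: d => [|d IH]; first by rewrite psum0 /delta leqn0 eq_sym.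
by rewrite psumS IH /delta -natrD; congr (_ %:R); case: (ltngtP e d.+1); lia.
Qed.

Lemma iter_psum_delta k e d :
  iter k.+1 psum (delta e) d = if (e <= d)%N then 'C(k + (d - e), k)%:Z else 0.
Proof.
elim: k d => [|k IH] d; first by rewrite /= psum_delta bin0; case: leqP.
rewrite iterS (eq_psum IH); elim: d => [|d IHd].
  rewrite psum0 leqn0; case: eqP => [->|//]; by rewrite !addn0 !binn.
rewrite psumS IHd; case: (ltngtP e d.+1) => [|lt_de|->].
- rewrite ltnS => le_ed; rewrite le_ed subSn // -PoszD; congr Posz.
  by rewrite [in RHS]addSn binS addnS addSn.
- by rewrite leqNgt ltnW // addr0.
by rewrite ltnn add0r subnn !addn0 !binn.
Qed.

(** The series is a finite sum of terms t^e/(1-t)^j with lo <= j <= hi. *)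
Definition decomposable (lo hi : nat) (f : nat -> int) : Prop :=
  exists2 L : seq (nat * nat), all (fun p => lo <= p.1 <= hi)%N L &
    forall d, f d = \sum_(p <- L) iter p.1 psum (delta p.2) d.

Lemma eq_decomposable lo hi f g : f =1 g ->
  decomposable lo hi f -> decomposable lo hi g.
Proof. by move=> eq_fg [L allL eL]; exists L => // d; rewrite -eq_fg. Qed.

Lemma decomposableW lo hi hi' f : (hi <= hi')%N ->
  decomposable lo hi f -> decomposable lo hi' f.
Proof.
move=> le_hi [L allL eL]; exists L => //; apply: sub_all allL => p.
by case/andP=> -> /leq_trans -> //.
Qed.

Lemma decomposableD lo hi f g : decomposable lo hi f -> decomposable lo hi g ->
  decomposable lo hi (fun d => f d + g d).
Proof.
move=> [L1 a1 e1] [L2 a2 e2]; exists (L1 ++ L2) => [|d]; first by rewrite all_cat a1.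
by rewrite big_cat e1 e2.
Qed.

Lemma decomposable_psum lo hi f : decomposable lo hi f ->
  decomposable lo.+1 hi.+1 (psum f).
Proof.
move=> [L aL eL]; exists [seq (p.1.+1, p.2) | p <- L] => [|d].
  by rewrite all_map.
by rewrite (eq_psum eL) psum_sum big_map.
Qed.

Lemma decomposable_iter k lo hi f : decomposable lo hi f ->
  decomposable (k + lo) (k + hi) (iter k psum f).
Proof. by move=> df; elim: k => //= k IH; apply: decomposable_psum. Qed.

Lemma decomposable_finite D (f : nat -> int) : (forall d, 0 <= f d) ->
  (forall d, (D <= d)%N -> f d = 0) -> decomposable 0 0 f.
Proof.
move=> f_ge0 f_eq0.
exists (flatten [seq nseq `|f e|%N (0%N, e) | e <- iota 0 D]) => [|d].
  apply/allP=> p /flattenP[s /mapP[e _ ->]] /nseqP[-> _].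
  by rewrite leqnn.
rewrite big_flatten big_map /=.
under eq_bigr => e _.
  rewrite big_nseq iter_addr_0 /= /delta -(mulr_natl _ `|f e|%N) (natz `|f e|%N) gez0_abs //.
  over.
case: (ltnP d D) => [lt_dD|le_Dd].
  rewrite (bigD1_seq d) ?iota_uniq ?mem_iota //= eqxx mulr1 big1 ?addr0 //.
  by move=> i; rewrite eq_sym => /negbTE ->; rewrite mulr0.
rewrite f_eq0 // big_seq big1 // => i; rewrite mem_iota add0n => lt_iD.
by rewrite gtn_eqF ?mulr0 // (leq_trans lt_iD).
Qed.

Definition tail (D : nat) (f : nat -> int) (d : nat) : int :=
  if (D <= d)%N then f d else 0.

(** Dividing by 1-t: the tail from D on of f/(1-t) is 1/(1-t) times the tail
    from D+1 on of f, corrected in degree D, where the partial sum jumps from 0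
    to its value. *)
Lemma tail_psum D f :
  tail D (psum f) =1 psum (fun d => psum f D * delta D d + tail D.+1 f d).
Proof.
elim=> [|d IH].
  rewrite psum0 /tail /delta ltn0 addr0 leqn0 eq_sym.
  by case: eqP => [->|_]; rewrite ?mulr1 ?mulr0.
rewrite psumS -IH /tail /delta; case: (ltngtP D d.+1) => [|lt_dD|->].
- by rewrite ltnS => le_Dd; rewrite le_Dd mulr0 add0r psumS.
- by rewrite leqNgt ltnW // mulr0 !add0r.
by rewrite ltnn mulr1 addr0 add0r.
Qed.

Lemma iter_psum_delta_ge0 k e d : 0 <= iter k psum (delta e) d.
Proof.
elim: k d => [|k IH] d; first by rewrite /= /delta; case: eqP.
by rewrite /= /psum sumr_ge0.
Qed.

Lemma decomposable_tail k D :
  decomposable 0 k (tail D (iter k psum (delta 0))).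
Proof.
elim: k D => [|k IH] D.
  apply: (@decomposable_finite 1) => d.
    by rewrite /tail /= /delta; case: leqP => // _; case: eqP.
  by rewrite /tail /= /delta; case: d => //= d _; case: ifP.
apply: eq_decomposable (fsym (@tail_psum D _)) _.
set f := iter k psum (delta 0).
have : decomposable 1 k.+1 (psum (fun d => psum f D * delta D d + tail D.+1 f d)).
  apply: decomposable_psum; apply: decomposableD (IH _).
  apply: decomposableW (leq0n k) _; apply: (@decomposable_finite D.+1) => d.
    by apply: mulr_ge0; [exact: (iter_psum_delta_ge0 k.+1)|rewrite /delta; case: eqP].
  by move=> lt_Dd; rewrite /delta gtn_eqF ?mulr0.
move=> [L aL eL]; exists L => //; apply: sub_all aL => p /andP[_ ->].
by rewrite leq0n.
Qed.

(** The coefficients of t(1-t)^b. *)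
Definition alt (b d : nat) : int :=
  if d is j.+1 then (- 1) ^+ j * 'C(b, j)%:Z else 0.

Lemma psum_alt b : psum (alt b.+1) =1 alt b.
Proof.
elim=> [|d IH]; first by rewrite psum0.
rewrite psumS IH; case: d {IH} => [|j] /=; first by rewrite !bin0 add0r.
rewrite binS PoszD exprS; ring.
Qed.

Lemma iter_psum_alt b : iter b psum (alt b) =1 delta 1.
Proof.
elim: b => [|b IH] d /=; last by rewrite -iterS iterSr (eq_iter_psum b (psum_alt b)).
by case: d => [|[|j]] //=; rewrite mulr0.
Qed.

(** Multiplying H by (1-t)^r gives 1/(1-t)^(a+1) + t(1-t)^(r-1), where
    a = n-r-1.  It is enough to decompose this series with exponents between 0
    and a+1.  Its coefficient in degree j+1 is C(a+j+1, j+1) + (-1)^j C(r-1, j). *)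
Lemma decomposable_star n r : (0 < r < n)%N ->
  (forall j, odd j -> 'C(r.-1, j) <= 'C(n - r.+1 + j.+1, j.+1))%N ->
  decomposable r n (fun d => iter n psum (delta 0) d + psum (delta 1) d).
Proof.
case: r => // b /= lt_rn hle.
set a := (n - b.+2)%N in hle.
pose f d : int := iter a.+1 psum (delta 0) d + alt b d.
have f_ge0 d : 0 <= f d.
  rewrite /f iter_psum_delta subn0; case: d => [|j] /=; first by rewrite addr0.
  rewrite -signr_odd; case: (boolP (odd j)) => [odd_j|_]; last by rewrite mul1r; lia.
  have := hle j odd_j; rewrite expr1 mulN1r -(@bin_sub _ a) ?leq_addr //.
  by rewrite addKn subr_ge0 lez_nat.
have df : decomposable 0 a.+1 f.
  have e : (fun d => (if (d < b.+2)%N then f d else 0)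
              + tail b.+2 (iter a.+1 psum (delta 0)) d) =1 f.
    move=> d; rewrite /tail ltnNge; case: leqP => /=; first by rewrite addr0.
    rewrite add0r /f => le_d; case: d le_d => //= j le_j.
    by rewrite (@bin_small b j) // mulr0 addr0.
  apply: eq_decomposable e _; apply: decomposableD (decomposable_tail _ _).
  apply: decomposableW (leq0n _) _; apply: (@decomposable_finite b.+2) => d.
    by case: ifP.
  by rewrite leqNgt => /negbTE ->.
have := decomposable_iter b.+1 df.
rewrite addn0; have {1}-> : (b.+1 + a.+1 = n)%N by rewrite /a; lia.
apply: eq_decomposable => d; rewrite iter_psumD -iterD.
have -> : (b.+1 + a.+1 = n)%N by rewrite /a; lia.
by congr (_ + _); rewrite iterS (eq_psum (iter_psum_alt b)).
Qed.

(** For g = r-1-a the condition (g+1)^2 <= 8a of [binom_odd_le] is the bound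
    s^2 <= n in disguise: n even gives g+1 = 2s-3 and 8a = 4n-8s+8, n odd gives
    g+1 = 2s-2 and 8a = 4n-8s+4.  When a >= r-1, so that g is not positive, it is
    applied with g = 0. *)
Lemma star_binom_le n s r : (s * s <= n)%N -> r = (uphalf n + s - 2)%N ->
  (0 < r)%N ->
  (r < n)%N /\
  forall j, odd j -> ('C(r.-1, j) <= 'C(n - r.+1 + j.+1, j.+1))%N.
Proof.
move=> le_sn er r_gt0.
have [m em] : exists m, n = m.*2 \/ n = m.*2.+1.
  by exists n./2; have := odd_double_half n; case: (odd n) => <-; [right|left]; lia.
have em' : uphalf n = (n - m)%N by case: em => ->; lia.
rewrite em' in er.
have lt_rn : (r < n)%N by case: em; nia.
split=> // j odd_j.
set a := (n - r.+1)%N.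
case: (leqP a r.-1) => [le_ar|lt_ra].
  have -> : r.-1 = (a + (r.-1 - a))%N by lia.
  apply: binom_odd_le => //.
  case: em => em; rewrite /a; nia.
apply: leq_trans (@leq_bin2l _ a _ _) _; first exact: ltnW.
have := @binom_odd_le a 0 j; rewrite addn0; apply => //; lia.
Qed.

(** * Regular sequences are algebraically independent *)

Section RegularBound.
Variables (K : fieldType) (m : nat).
Local Notation S := {mpoly K[m]}.

Lemma in_idealM_rcons (N : lmodType S) (s : seq S) f (w y : N) :
  in_idealM s w -> in_idealM (rcons s f) (w + f *: y).
Proof.
case=> v ->; pose v' k := if insub k is Some i then v i else y.
exists (fun i : 'I_(size (rcons s f)) => v' i).
pose F k := (rcons s f)`_k *: v' k.
rewrite -(big_mkord xpredT F) size_rcons big_nat_recr //= big_mkord.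
congr (_ + _); last by rewrite /F /v' insubF ?ltnn // nth_rcons ltnn eqxx.
by apply: eq_bigr => i _; rewrite /F /v' valK nth_rcons ltn_ord.
Qed.

(** The elements g_t are linearly independent over K, even when acting on the
    class of u modulo (s)N. *)
Definition indep_mod (N : lmodType S) (s : seq S) (u : N) (T : finType)
    (g : T -> S) : Prop :=
  forall c : T -> K, in_idealM s ((\sum_t (c t)%:MP * g t) *: u) ->
    forall t, c t = 0.

(** In a relation between the f^i g_t the terms with i = 0 form a relation
    between the g_t modulo (s, f)N, hence vanish.  The remaining terms are
    divisible by f, which can be cancelled modulo (s)N; the number of powers has
    decreased. *)
Lemma indep_mod_powers (N : lmodType S) (s : seq S) (f : S) (u : N)
    (T : finType) (g : T -> S) B :
  (forall v : N, in_idealM s (f *: v) -> in_idealM s v) ->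
  indep_mod (rcons s f) u g ->
  indep_mod s u (fun p : 'I_B * T => f ^+ p.1 * g p.2).
Proof.
move=> reg_f ind_g.
have powers : forall (c : 'I_B -> T -> K),
    in_idealM s ((\sum_(i < B) f ^+ i * \sum_t (c i t)%:MP * g t) *: u) ->
    forall i t, c i t = 0.
  elim: B => [|B IH] c; first by move=> _ [].
  rewrite big_ord_recl expr0 mul1r.
  set P := \sum_t _; pose Q := \sum_(i < B) f ^+ i * \sum_t (c (lift ord0 i) t)%:MP * g t.
  have -> : \sum_(i < B) f ^+ lift ord0 i * (\sum_t (c (lift ord0 i) t)%:MP * g t) = f * Q.
    by rewrite mulr_sumr; apply: eq_bigr => i _; rewrite exprS mulrA.
  move=> h; have c0 : forall t, c ord0 t = 0.
    apply: ind_g; have := in_idealM_rcons f (- (Q *: u)) h.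
    by rewrite scalerDl scalerN scalerA addrK.
  have P0 : P = 0 by rewrite /P big1 // => t _; rewrite c0 mpolyC0 mul0r.
  rewrite P0 add0r -scalerA in h; move/reg_f/IH in h.
  by move=> i t; case: (unliftP ord0 i) => [j ->|->].
move=> c h [i t]; apply: (powers (fun i t => c (i, t))) => {i t}.
congr (in_idealM s (_ *: u)): h.
transitivity (\sum_(i < B) \sum_t (c (i, t))%:MP * (f ^+ i * g t)).
  by rewrite pair_bigA; apply: eq_bigr => -[].
by apply: eq_bigr => i _; rewrite mulr_sumr; apply: eq_bigr => t _; rewrite mulrCA.
Qed.

Lemma msizeM_pred_le (p q : S) : (msize (p * q) <= (msize p + msize q).-1)%N.
Proof.
have [->|nz_p] := eqVneq p 0; first by rewrite mul0r msize0.
have [->|nz_q] := eqVneq q 0; first by rewrite mulr0 msize0.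
by rewrite msizeM.
Qed.

Lemma msize_exp_le (f : S) e i : (0 < e)%N -> (msize f <= e)%N ->
  (msize (f ^+ i) <= i.+1 * e)%N.
Proof.
move=> e_gt0 le_fe; elim: i => [|i IH]; first by rewrite expr0 msize1 mul1n.
rewrite exprS mulSn; apply: leq_trans (msizeM_pred_le _ _) _; lia.
Qed.

(** The family consists of the monomials in the elements of s with all exponents
    below B.  It is built from the last element of s backwards, so that each
    step is an instance of [indep_mod_powers]. *)
Lemma regular_seq_family (N : lmodType S) (s : seq S) (u : N) (B e : nat) :
  regular_seq N s -> ~ in_idealM s u -> (0 < e)%N ->
  (forall p, p \in s -> (msize p <= e)%N) ->
  exists (T : finType) (g : T -> S),
    [/\ #|T| = (B ^ size s)%N, indep_mod [::] u g
      & forall t, (msize (g t) <= (size s * (B * e)).+1)%N].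
Proof.
case=> _ reg_s _ nu e_gt0 le_se.
suff : forall k, (k <= size s)%N -> exists (T : finType) (g : T -> S),
    [/\ #|T| = (B ^ k)%N, indep_mod (take (size s - k) s) u g
      & forall t, (msize (g t) <= (k * (B * e)).+1)%N].
  by move=> /(_ _ (leqnn _)); rewrite subnn take0.
elim=> [|k IH] lt_k.
  exists unit, (fun=> 1); split=> [|c|_]; rewrite ?card_unit ?msize1 //.
  rewrite subn0 take_size (bigD1 tt) //= big1 => [|[] //].
  rewrite addr0 mulr1 => h t.
  apply/eqP/negP => /negP c0; apply: nu; case: h => v hv.
  exists (fun i => (c tt)^-1%:MP *: v i).
  have -> : u = (c tt)^-1%:MP *: ((c tt)%:MP *: u).
    by rewrite scalerA -mpolyCM mulVf ?mpolyC1 ?scale1r //; case: t c0.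
  rewrite hv scaler_sumr; apply: eq_bigr => i _.
  by rewrite !scalerA mulrC.
have [T [g [cT ind_g le_g]]] := IH (ltnW lt_k).
have lt_i : (size s - k.+1 < size s)%N by lia.
exists ('I_B * T)%type, (fun p : 'I_B * T => s`_(size s - k.+1) ^+ p.1 * g p.2).
split=> [||[i t] /=].
- by rewrite card_prod card_ord cT expnS.
- apply: indep_mod_powers (reg_s _ lt_i) _.
  by rewrite -take_nth // -subSn // subSS in ind_g *.
apply: leq_trans (msizeM_pred_le _ _) _.
have le_f := msize_exp_le i e_gt0 (le_se _ (mem_nth 0 lt_i)).
have le_i : (i.+1 * e <= B * e)%N by rewrite leq_mul2r ltn_ord orbT.
have := leq_add (leq_trans le_f le_i) (le_g t); rewrite mulSn.
set x := (_ + _)%N => le_x; lia.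
Qed.

(** A polynomial of degree less than D is determined by its coefficients at the
    exponents in [0, D)^m, so g_t gives the rows of a matrix with D^m columns
    that are linearly independent. *)
Lemma indep_card_le (T : finType) (g : T -> S) D :
  (forall c : T -> K, \sum_t (c t)%:MP * g t = 0 -> forall t, c t = 0) ->
  (forall t, (msize (g t) <= D)%N) -> (#|T| <= D ^ m)%N.
Proof.
move=> ind_g le_g.
pose A := \matrix_(i < #|T|, j < #|{ffun 'I_m -> 'I_D}|)
  (g (enum_val i))@_[multinom (enum_val j l : nat) | l < m].
have : row_free A.
  apply: inj_row_free => v vA0; apply/rowP=> i; rewrite mxE.
  rewrite -(enum_valK i); apply: (ind_g (fun t => v 0 (enum_rank t))).
  apply/mpolyP => mm; rewrite mcoeff0 raddf_sum /=.
  case: (boolP [forall l, mm l < D]%N) => [/forallP lt_mm|/forallPn[l]].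
    pose j := enum_rank [ffun l => Ordinal (lt_mm l)].
    have := congr1 (fun w : 'rV_ _ => w 0 j) vA0; rewrite !mxE => e0; rewrite -[RHS]e0.
    rewrite (reindex (@enum_val T T)) /=; last first.
      by exists enum_rank => ? _; rewrite ?enum_valK ?enum_rankK.
    apply: eq_bigr => k _; rewrite mcoeffCM enum_valK !mxE enum_rankK.
    congr (_ * _@__); apply/mnmP=> l; by rewrite mnmE ffunE.
  rewrite -leqNgt => le_Dl; rewrite big1 // => t _; rewrite mcoeffCM.
  rewrite (memN_msupp_eq0 (msize_mdeg_ge _)) ?mulr0 //.
  apply: leq_trans (le_g t) (leq_trans le_Dl _).
  by rewrite mdegE (bigD1 l) //= leq_addr.
rewrite /row_free => /eqP <-; apply: leq_trans (rank_leq_col _) _.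
by rewrite card_ffun !card_ord.
Qed.

(** If the length k of s exceeded m, the B^k monomials of [regular_seq_family]
    would lie in a space of dimension at most (BC)^m, where C does not depend on
    B; this is absurd for B > C^m. *)
Lemma regular_seq_size_le (N : lmodType S) (s : seq S) :
  regular_seq N s -> (size s <= m)%N.
Proof.
move=> reg_s; have [_ _ [u nu]] := reg_s; rewrite leqNgt; apply/negP => lt_m.
pose e := (\max_(p <- s) msize p).+1.
have le_e p : p \in s -> (msize p <= e)%N.
  by move=> ps; apply: leqW; rewrite (big_rem p ps) leq_maxl.
pose C := (size s * e).+1; pose B := (C ^ m).+1.
have [T [g [cT ind_g le_g]]] := regular_seq_family B reg_s nu (ltn0Sn _) le_e.
have : (#|T| <= (B * C) ^ m)%N.
  apply: indep_card_le => [c c0|t]; last by apply: leq_trans (le_g t) _; rewrite /C; nia.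
  by apply: ind_g; rewrite c0 scale0r; exists (fun=> 0); rewrite big_ord0.
rewrite cT expnMn leqNgt => /negP; apply.
apply: (@leq_trans (B ^ m.+1)).
  by rewrite expnS mulnC ltn_pmul2r ?expn_gt0.
by rewrite leq_exp2l // /B ltnS expn_gt0.
Qed.

End RegularBound.

(** * Monomial ideals *)

Section Extended.
Variables (K : fieldType) (m : nat).
Local Notation S := {mpoly K[m]}.

Section InIdealM.
Variables (N : lmodType S) (s : seq S).

Lemma in_idealM0 : @in_idealM K m N s 0.
Proof. by exists (fun=> 0); rewrite big1 // => i _; rewrite scaler0. Qed.

Lemma in_idealMD (u v : N) : in_idealM s u -> in_idealM s v -> in_idealM s (u + v).
Proof.
move=> [a ->] [b ->]; exists (fun i => a i + b i).
by rewrite -big_split; apply: eq_bigr => i _; rewrite scalerDr.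
Qed.

Lemma in_idealM_sum (I : Type) (r : seq I) (P : pred I) (F : I -> N) :
  (forall i, P i -> in_idealM s (F i)) -> in_idealM s (\sum_(i <- r | P i) F i).
Proof. exact: (big_ind _ in_idealM0 in_idealMD). Qed.

Lemma in_idealM_gen f (v : N) : f \in s -> in_idealM s (f *: v).
Proof.
move=> fs; have lt_i : (index f s < size s)%N by rewrite index_mem.
exists (fun i => if i == Ordinal lt_i then v else 0).
rewrite (bigD1 (Ordinal lt_i)) //= eqxx nth_index // big1 ?addr0 // => i.
by move=> /negbTE ->; rewrite scaler0.
Qed.

End InIdealM.

Lemma in_ideal_gen (s : seq S) f : f \in s -> in_ideal s f.
Proof.
move=> fs; rewrite /in_ideal -[f]mulr1.
exact: (@in_idealM_gen S^o s f 1).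
Qed.

Definition monomials (gs : seq 'X_{1..m}) : seq S := [seq 'X_[g] | g <- gs].

Definition divisible (gs : seq 'X_{1..m}) (mm : 'X_{1..m}) : bool :=
  has (fun g => (g <= mm)%MM) gs.

Lemma mcoeffMX_ndiv (g mm : 'X_{1..m}) (p : S) :
  ~~ (g <= mm)%MM -> ('X_[g] * p)@_mm = 0.
Proof.
move=> ndiv; rewrite mulrC; apply: memN_msupp_eq0.
rewrite (perm_mem (msuppMX _ _)); apply: contra ndiv => /mapP[m' _ ->].
exact: lem_addr.
Qed.

Lemma mcoeff_monomial_sum (gs : seq 'X_{1..m}) (v : 'I_(size (monomials gs)) -> S) mm :
  ~~ divisible gs mm -> (\sum_(i < size (monomials gs)) (monomials gs)`_i * v i)@_mm = 0.
Proof.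
move=> ndiv; rewrite raddf_sum big1 //= => i _.
have lt_i : (i < size gs)%N by rewrite -(size_map (@mpolyX m K)).
rewrite (nth_map 0%MM) //; apply: mcoeffMX_ndiv.
by apply: contra ndiv => le_g; apply/hasP; exists (nth 0%MM gs i); rewrite ?mem_nth.
Qed.

Lemma in_ideal_monomialsP gs (p : S) :
  in_ideal (monomials gs) p <-> (forall mm, ~~ divisible gs mm -> p@_mm = 0).
Proof.
split=> [[v ->] mm|h]; first exact: mcoeff_monomial_sum.
rewrite [p]mpolyE; apply: (@in_idealM_sum S^o) => mm _.
have [/hasP[g gs_g le_g]|/h->] := boolP (divisible gs mm); last first.
  by rewrite scale0r; apply: (@in_idealM0 S^o).
rewrite -[X in 'X_[X]](submK le_g) mpolyXD mulrC scalerAr.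
by apply: (@in_idealM_gen S^o); apply: map_f.
Qed.

(** The submodule generated by gs in S/(hs) is the image of the monomial ideal
    generated by gs and hs. *)
Lemma in_idealM_monomialsP gs hs (p : S) :
  in_idealM (monomials gs) (cyclic_pi (monomials hs) p) <->
  (forall mm, ~~ divisible gs mm -> ~~ divisible hs mm -> p@_mm = 0).
Proof.
split=> [[v hv] mm ngs nhs|h].
  have vP i : exists q, v i = cyclic_pi (monomials hs) q by apply: cyclic_piP.
  have [q qP] := choice vP.
  pose a : S := \sum_(i < size (monomials gs)) (monomials gs)`_i * q i.
  have : p - a \in ideal (monomials hs).
    apply/cyclic_pi_eq; rewrite hv raddf_sum; apply: eq_bigr => i _.
    by rewrite qP cyclic_piZ.
  move/idealP/in_ideal_monomialsP/(_ mm nhs); rewrite mcoeffB mcoeff_monomial_sum //.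
  by rewrite subr0.
rewrite [p]mpolyE raddf_sum; apply: in_idealM_sum => mm _.
have [/hasP[g gs_g le_g]|ngs] := boolP (divisible gs mm).
  rewrite -[X in 'X_[X]](submK le_g) mpolyXD mulrC scalerAr /= -cyclic_piZ.
  by apply: in_idealM_gen; apply: map_f.
rewrite /= (_ : cyclic_pi _ _ = 0); first exact: in_idealM0.
apply/cyclic_pi_eq0/idealP/in_ideal_monomialsP => mm' nhs.
rewrite mcoeffZ mcoeffX; case: eqP => [e|_]; rewrite ?mulr0 // e h ?mul0r -?e //.
by rewrite e.
Qed.

Lemma divisible_variables (l : seq 'I_m) mm :
  divisible [seq U_(i)%MM | i <- l] mm = has (fun i => 0 < mm i)%N l.
Proof.
rewrite /divisible has_map; apply: eq_has => i /=.
apply/mnm_lepP/idP => [/(_ i)|h j]; rewrite mnm1E ?eqxx //.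
by case: eqP => // <-.
Qed.

(** The second clause of [regular_seq], which is the part that passes to direct
    sums unconditionally. *)
Definition weakly_regular (N : lmodType S) (s : seq S) : Prop :=
  forall i, (i < size s)%N -> forall u : N,
    in_idealM (take i s) (s`_i *: u) -> in_idealM (take i s) u.

Definition variables (l : seq 'I_m) : seq S := monomials [seq U_(i)%MM | i <- l].

(** Multiplying a monomial by a variable does not make it divisible by any
    other variable. *)
Lemma weakly_regular_variables (l h : seq 'I_m) : uniq (l ++ h) ->
  weakly_regular (cyclic_module (variables h)) (variables l).
Proof.
move=> uniq_lh i; rewrite !size_map => lt_i u; have [p ->] := cyclic_piP u.
have -> : take i (variables l) = variables (take i l).
  by rewrite /variables /monomials !map_take.
pose x0 := tnth (in_tuple l) (Ordinal lt_i).
rewrite (nth_map 0%MM) ?size_map // (nth_map x0) //.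
set x := nth x0 l i; rewrite cyclic_piZ => /in_idealM_monomialsP hp.
apply/in_idealM_monomialsP => mm; rewrite !divisible_variables => nl nh.
rewrite -(mcoeffMX p U_(x)) mulrC; apply: hp; rewrite divisible_variables.
  apply: contra nl => /hasP[k kl]; rewrite mnmDE mnm1E => pos; apply/hasP; exists k => //.
  move: pos; case: eqP => [e|_]; last by rewrite add0n.
  have : uniq l by move: uniq_lh; rewrite cat_uniq => /and3P[].
  rewrite -{1}(cat_take_drop i l) cat_uniq => /and3P[_ /hasPn/(_ k) ndrop _].
  have /ndrop/negP[] : k \in drop i l by rewrite -e (drop_nth x0) // mem_head.
  exact: kl.
apply: contra nh => /hasP[k kh]; rewrite mnmDE mnm1E => pos; apply/hasP; exists k => //.
move: pos; case: eqP => [e|_]; last by rewrite add0n.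
move: uniq_lh; rewrite cat_uniq => /and3P[_ /hasPn/(_ k kh)/negP nkl _].
by case: nkl; rewrite -e mem_nth.
Qed.

Lemma variables_proper (l h : seq 'I_m) :
  ~ in_idealM (variables l) (cyclic_pi (variables h) 1).
Proof.
move/in_idealM_monomialsP/(_ 0%MM); rewrite mcoeff1 eqxx => h1.
suff /eqP : (1 : K) = 0 by rewrite oner_eq0.
by apply: h1; rewrite divisible_variables; apply/hasPn => i _; rewrite mnm0E.
Qed.

Definition std_monomials (gs : seq 'X_{1..m}) (e : nat) : {set 'X_{1..m < e.+1}} :=
  [set mm : 'X_{1..m < e.+1} | (mdeg mm == e) && ~~ divisible gs mm].

Definition std_count (gs : seq 'X_{1..m}) (d : int) : nat :=
  if d is Posz e then #|std_monomials gs e| else 0%N.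

(** The standard monomials of degree d, those outside the monomial ideal, form a
    basis of the component of degree d of the quotient. *)
Lemma has_dim_monomials gs (hs : forall p, p \in monomials gs -> exists e : nat, p \is e.-homog) d :
  has_dim (graded_cyclic_module hs) d (std_count gs d).
Proof.
case: d => [e|e]; last first.
  exists (fun=> 0); split=> [i|u /= ->|c _ []] //.
  by exists (fun=> 0); rewrite big1 // => i _; rewrite scaler0.
rewrite /=; set A := std_monomials gs e.
pose f (i : 'I_#|A|) : 'X_{1..m} := enum_val i.
have fP i : (mdeg (f i) == e) && ~~ divisible gs (f i).
  by have := enum_valP i; rewrite inE.
have f_inj : injective f by move=> i j /val_inj /enum_val_inj.
have fsum (c : 'I_#|A| -> K) : \sum_i (c i)%:MP *: cyclic_pi (monomials gs) 'X_[f i] =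
    cyclic_pi (monomials gs) (\sum_i c i *: 'X_[f i]).
  by rewrite raddf_sum; apply: eq_bigr => i _; rewrite cyclic_piZ mul_mpolyC.
have coef (c : 'I_#|A| -> K) i0 : (\sum_i c i *: 'X_[f i])@_(f i0) = c i0.
  rewrite raddf_sum (bigD1 i0) //= mcoeffZ mcoeffX eqxx mulr1 big1 ?addr0 // => i ne.
  by rewrite mcoeffZ mcoeffX (inj_eq f_inj) (negbTE ne) mulr0.
exists (fun i => cyclic_pi (monomials gs) 'X_[f i]); split=> [i|u|c].
- by exists 'X_[f i] => //; rewrite dhomogX; case/andP: (fP i).
- case=> p hp ->; exists (fun i => p@_(f i)); rewrite fsum.
  apply/cyclic_pi_eq/idealP/in_ideal_monomialsP => mm nmm.
  rewrite mcoeffB; apply/eqP; rewrite subr_eq0; apply/eqP.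
  have [emm|nemm] := eqVneq (mdeg mm) e.
    have lt_mm : (mdeg mm < e.+1)%N by rewrite emm.
    have mmA : BMultinom lt_mm \in A by rewrite inE emm eqxx.
    have -> : mm = f (enum_rank_in mmA (BMultinom lt_mm)) by rewrite /f enum_rankK_in.
    by rewrite (coef (fun i => p@_(f i))).
  rewrite (dhomog_nemf_coeff hp nemm) raddf_sum big1 //= => i _.
  rewrite mcoeffZ mcoeffX; case: eqP => [ei|_]; rewrite ?mulr0 //.
  by case/andP: (fP i); rewrite ei (negbTE nemm).
rewrite fsum => /cyclic_pi_eq0/idealP/in_ideal_monomialsP h0 i.
by rewrite -(coef c i); apply: h0; case/andP: (fP i).
Qed.

End Extended.

(** * Shifts and direct sums of graded modules *)

Lemma split_lshift (k1 k2 : nat) (i : 'I_k1) : split (lshift k2 i) = inl i.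
Proof. exact: (unsplitK (inl i)). Qed.

Lemma split_rshift (k1 k2 : nat) (i : 'I_k2) : split (rshift k1 i) = inr i.
Proof. exact: (unsplitK (inr i)). Qed.

Section Constructions.
Variables (K : fieldType) (m : nat).
Local Notation S := {mpoly K[m]}.

Section Shift.
Variables (M : gradedModule K m) (e : int).

(** The shift of M that places the component of degree 0 in degree e. *)
Definition shift_part (d : int) (u : M) : Prop := gpart (d - e) u.

Lemma shift_part0 d : shift_part d 0.
Proof. exact: gpart0. Qed.

Lemma shift_partD d u v : shift_part d u -> shift_part d v -> shift_part d (u + v).
Proof. exact: gpartD. Qed.

Lemma shift_partZ (k : nat) d (p : S) u :
  p \is k.-homog -> shift_part d u -> shift_part (k%:Z + d) (p *: u).
Proof. by rewrite /shift_part -addrA; apply: gpartZ. Qed.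

Lemma shift_part_sum u : exists (s : seq int) (c : int -> M),
  [/\ uniq s, (forall d, shift_part d (c d)) & u = \sum_(d <- s) c d].
Proof.
have [s [c [uniq_s c_part ->]]] := gpart_sum u.
exists [seq d + e | d <- s], (fun d => c (d - e)); split=> [|d|].
- by rewrite map_inj_uniq //; apply: addIr.
- exact: c_part.
by rewrite big_map; apply: eq_bigr => d _; rewrite addrK.
Qed.

Lemma shift_part_free (s : seq int) (c : int -> M) :
  uniq s -> (forall d, shift_part d (c d)) -> \sum_(d <- s) c d = 0 ->
  forall d, d \in s -> c d = 0.
Proof.
move=> uniq_s c_part sum0 d d_s; rewrite -[d](subrK e).
apply: (@gpart_free _ _ M [seq x - e | x <- s] (fun x => c (x + e))).
- by rewrite map_inj_uniq //; apply: addIr.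
- by move=> x; have := c_part (x + e); rewrite /shift_part addrK.
- by rewrite big_map -[RHS]sum0; apply: eq_bigr => x _; rewrite subrK.
exact: map_f.
Qed.

Definition shift_module : gradedModule K m :=
  GradedModule shift_part0 shift_partD shift_partZ shift_part_sum shift_part_free.

Lemma has_dim_shift d k : has_dim M (d - e) k -> has_dim shift_module d k.
Proof. by []. Qed.

End Shift.

Section DirectSum.
Variables (M1 M2 : gradedModule K m).
Let N : lmodType S := (M1 * M2)%type.

Definition dsum_part (d : int) (u : N) : Prop := gpart d u.1 /\ gpart d u.2.

Lemma dsum_part0 d : dsum_part d 0.
Proof. by split; apply: gpart0. Qed.

Lemma dsum_partD d u v : dsum_part d u -> dsum_part d v -> dsum_part d (u + v).
Proof. by move=> [u1 u2] [v1 v2]; split; apply: gpartD. Qed.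

Lemma dsum_partZ (e : nat) d (p : S) u :
  p \is e.-homog -> dsum_part d u -> dsum_part (e%:Z + d) (p *: u).
Proof. by move=> hp [u1 u2]; split; apply: gpartZ. Qed.

Lemma pair_sum (I : Type) (r : seq I) (F1 : I -> M1) (F2 : I -> M2) :
  \sum_(i <- r) ((F1 i, F2 i) : N) = (\sum_(i <- r) F1 i, \sum_(i <- r) F2 i).
Proof. by elim: r => [|i r IH]; rewrite ?big_nil // !big_cons IH. Qed.

(** Used to write the homogeneous decompositions of the two components of a pair
    over a common set of degrees. *)
Lemma sum_undup (V : nmodType) (I : eqType) (r s : seq I) (F : I -> V) :
  uniq r -> uniq s -> {subset s <= r} ->
  \sum_(d <- r) (if d \in s then F d else 0) = \sum_(d <- s) F d.
Proof.
move=> uniq_r uniq_s sub; rewrite -big_mkcond -big_filter.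
apply: perm_big; apply: uniq_perm; rewrite ?filter_uniq // => d.
by rewrite mem_filter andb_idr //; apply: sub.
Qed.

Lemma dsum_part_sum u : exists (s : seq int) (c : int -> N),
  [/\ uniq s, (forall d, dsum_part d (c d)) & u = \sum_(d <- s) c d].
Proof.
case: u => u1 u2.
have [s1 [c1 [un1 p1 ->]]] := gpart_sum u1.
have [s2 [c2 [un2 p2 ->]]] := gpart_sum u2.
exists (undup (s1 ++ s2)).
exists (fun d => (if d \in s1 then c1 d else 0, if d \in s2 then c2 d else 0)).
split; first exact: undup_uniq.
  by move=> d; split=> /=; case: ifP => // _; apply: gpart0.
by rewrite pair_sum !sum_undup ?undup_uniq // => d ds;
  rewrite mem_undup mem_cat ds ?orbT.
Qed.

Lemma dsum_part_free (s : seq int) (c : int -> N) :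
  uniq s -> (forall d, dsum_part d (c d)) -> \sum_(d <- s) c d = 0 ->
  forall d, d \in s -> c d = 0.
Proof.
move=> uniq_s c_part; under eq_bigr => d _ do rewrite [c d]surjective_pairing.
rewrite pair_sum => -[sum1 sum2] d d_s; rewrite [c d]surjective_pairing.
congr (_, _).
  by apply: (gpart_free uniq_s _ sum1) => // x; case: (c_part x).
by apply: (gpart_free uniq_s _ sum2) => // x; case: (c_part x).
Qed.

Definition dsum_module : gradedModule K m :=
  GradedModule dsum_part0 dsum_partD dsum_partZ dsum_part_sum dsum_part_free.

Definition dsum_family k1 k2 (g1 : 'I_k1 -> M1) (g2 : 'I_k2 -> M2)
    (i : 'I_(k1 + k2)) : dsum_module :=
  match split i with inl j => (g1 j, 0) | inr j => (0, g2 j) end.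

Lemma dsum_family_sum k1 k2 (g1 : 'I_k1 -> M1) (g2 : 'I_k2 -> M2)
    (a : 'I_(k1 + k2) -> S) :
  \sum_i a i *: dsum_family g1 g2 i =
  (\sum_i a (lshift k2 i) *: g1 i, \sum_i a (rshift k1 i) *: g2 i).
Proof.
transitivity (\sum_i ((a i *: (dsum_family g1 g2 i).1,
                       a i *: (dsum_family g1 g2 i).2) : N)).
  by apply: eq_bigr.
rewrite pair_sum /dsum_family; congr (_, _); rewrite big_split_ord /=.
  rewrite [X in _ + X]big1 ?addr0 => [|i _]; last by rewrite split_rshift scaler0.
  by apply: eq_bigr => i _; rewrite split_lshift.
rewrite [X in X + _]big1 ?add0r => [|i _]; last by rewrite split_lshift scaler0.
by apply: eq_bigr => i _; rewrite split_rshift.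
Qed.

Lemma finitely_generated_dsum :
  finitely_generated M1 -> finitely_generated M2 -> finitely_generated dsum_module.
Proof.
move=> [k1 [g1 gen1]] [k2 [g2 gen2]].
exists (k1 + k2)%N, (dsum_family g1 g2) => -[u1 u2].
have [a1 ->] := gen1 u1; have [a2 ->] := gen2 u2.
exists (fun i => match split i with inl j => a1 j | inr j => a2 j end).
rewrite dsum_family_sum; congr (_, _); apply: eq_bigr => i _.
  by rewrite split_lshift.
by rewrite split_rshift.
Qed.

Lemma has_dim_dsum d k1 k2 :
  has_dim M1 d k1 -> has_dim M2 d k2 -> has_dim dsum_module d (k1 + k2).
Proof.
move=> [b1 [part1 gen1 free1]] [b2 [part2 gen2 free2]].
exists (dsum_family b1 b2); split=> [i|[u1 u2] [/= h1 h2]|c].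
- by rewrite /dsum_family; case: split => j; split=> //=; apply: gpart0.
- have [c1 ->] := gen1 _ h1; have [c2 ->] := gen2 _ h2.
  exists (fun i => match split i with inl j => c1 j | inr j => c2 j end).
  rewrite (dsum_family_sum _ _ (fun i =>
    (match split i with inl j => c1 j | inr j => c2 j end)%:MP)).
  congr (_, _); apply: eq_bigr => i _; first by rewrite split_lshift.
  by rewrite split_rshift.
rewrite (dsum_family_sum _ _ (fun i => (c i)%:MP)) => -[h1 h2] i.
have c1 := free1 _ h1; have c2 := free2 _ h2.
by rewrite -[i]splitK; case: split => j /=.
Qed.

Lemma in_idealM_dsum (s : seq S) (u : dsum_module) :
  in_idealM s u <-> in_idealM s u.1 /\ in_idealM s u.2.
Proof.
case: u => u1 u2; split=> [[v]|[[v1 /= ->] [v2 ->]]]; last first.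
  by exists (fun i => (v1 i, v2 i)); rewrite -pair_sum.
under eq_bigr => i _ do rewrite [v i]surjective_pairing.
rewrite (pair_sum _ (fun i : 'I_(size s) => s`_i *: (v i).1)
                    (fun i => s`_i *: (v i).2)) => -[-> ->].
by split; [exists (fun i => (v i).1)|exists (fun i => (v i).2)].
Qed.

Lemma weakly_regular_dsum (s : seq S) :
  weakly_regular M1 s -> weakly_regular M2 s -> weakly_regular dsum_module s.
Proof.
move=> reg1 reg2 i lt_i u /in_idealM_dsum[h1 h2]; apply/in_idealM_dsum.
by split; [apply: reg1 h1|apply: reg2 h2].
Qed.

End DirectSum.
End Constructions.

(** * Counting standard monomials *)

Section Counting.
Variable m : nat.

Definition last_variables (j : nat) : seq 'I_m := [seq i : 'I_m <- enum 'I_m | (j <= i)%N].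

Definition last_units (j : nat) : seq 'X_{1..m} := [seq U_(i)%MM | i <- last_variables j].

Lemma divisible_last_units j mm :
  divisible (last_units j) mm = [exists i : 'I_m, (j <= i)%N && (0 < mm i)%N].
Proof.
rewrite divisible_variables; apply/hasP/existsP => [[i]|[i /andP[le_ji pos]]].
  by rewrite mem_filter => /andP[le_ji _] pos; exists i; rewrite le_ji.
by exists i; rewrite // mem_filter le_ji mem_enum.
Qed.

(** These are the monomials of degree e in the first j variables, that is, the
    j-tuples of natural numbers of sum e. *)
Lemma card_std_monomials j e : (0 < j <= m)%N ->
  #|std_monomials (last_units j) e| = 'C(j.-1 + e, j.-1).
Proof.
case: j => // j /= le_jm; rewrite -card_ord_partitions.
pose w := widen_ord le_jm.
pose f (mm : 'X_{1..m < e.+1}) : j.+1.-tuple 'I_e.+1 := [tuple inord (mm (w l)) | l < j.+1].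
have vanish mm (i : 'I_m) : mm \in std_monomials (last_units j.+1) e ->
    (j < i)%N -> (mm : 'X_{1..m}) i = 0%N.
  rewrite inE divisible_last_units => /andP[_ /existsPn/(_ i)] h lt_ji.
  by move: h; rewrite lt_ji /= -eqn0Ngt => /eqP.
have small (mm : 'X_{1..m < e.+1}) i : ((mm : 'X_{1..m}) i < e.+1)%N.
  by apply: leq_ltn_trans (bmdeg mm); rewrite mdegE (bigD1 i) //= leq_addr.
have sumE (g : 'I_m -> nat) : (forall i : 'I_m, (j < i)%N -> g i = 0%N) ->
    (\sum_i g i = \sum_(l < j.+1) g (w l))%N.
  move=> g0; rewrite (bigID (fun i : 'I_m => (i < j.+1)%N)) /= [X in (_ + X)%N]big1 ?addn0.
    by rewrite (big_ord_narrow le_jm).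
  by move=> i; rewrite -leqNgt; apply: g0.
have f_inj : {in std_monomials (last_units j.+1) e &, injective f}.
  move=> mm1 mm2 h1 h2 /(congr1 (fun t => tnth t)) eq_f; apply/val_inj/mnmP => i /=.
  case: (ltnP j i) => [lt_ji|le_ij]; first by rewrite !vanish.
  have := congr1 (fun t => t (Ordinal (le_ij : (i < j.+1)%N))) eq_f.
  rewrite !tnth_mktuple => /(congr1 val) /=; rewrite !inordK ?small //=.
  by have -> : w (Ordinal (le_ij : (i < j.+1)%N)) = i by apply: val_inj.
rewrite -(card_in_imset f_inj); apply: eq_card => t; rewrite inE.
apply/imsetP/idP => [[mm mmA ->]|/eqP sum_t].
  rewrite big_tuple; apply/eqP.
  under eq_bigr => l _ do rewrite tnth_mktuple inordK ?small //.
  rewrite -(sumE (fun i => (mm : 'X_{1..m}) i)) => [|i]; last exact: vanish.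
  by rewrite -mdegE; move: mmA; rewrite inE => /andP[/eqP].
pose g := [multinom (if insub (i : nat) is Some l then (tnth t l : nat) else 0%N) | i < m].
have g0 (i : 'I_m) : (j < i)%N -> g i = 0%N.
  by move=> lt_ji; rewrite mnmE insubF //; apply/negbTE; rewrite -leqNgt.
have gw l : g (w l) = tnth t l.
  by rewrite mnmE; have -> : insub (w l : nat) = Some l by apply: valK.
have deg_g : mdeg g = e.
  rewrite mdegE (sumE (fun i => g i) g0) -[RHS]sum_t big_tuple.
  by apply: eq_bigr => l _; apply: gw.
have lt_g : (mdeg g < e.+1)%N by rewrite deg_g.
exists (BMultinom lt_g).
  rewrite inE deg_g eqxx divisible_last_units; apply/existsPn => i.
  by rewrite negb_and -!leqNgt; case: ltnP => //= lt_ji; rewrite g0.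
by apply: eq_from_tnth => l; rewrite tnth_mktuple gw inord_val.
Qed.

Lemma std_count_last_units j (e : nat) (d : nat) : (0 < j <= m)%N ->
  (std_count (last_units j) (d%:Z - e%:Z))%:Z = iter j psum (delta e) d.
Proof.
move=> hj; have -> : j = j.-1.+1 by lia.
rewrite iter_psum_delta; case: leqP => [le_ed|lt_de].
  by rewrite subzn //= card_std_monomials // prednK //; case/andP: hj.
have -> : d%:Z - e%:Z = Negz (e - d).-1 by rewrite NegzE; lia.
by [].
Qed.

Lemma std_count_lt0 gs (d : int) : d < 0 -> @std_count m gs d = 0%N.
Proof. by case: d. Qed.

End Counting.

Section Star.
Variable n : nat.

Definition star_monomials : seq 'X_{1..n.+1} :=
  [seq (U_(widen_ord (leqnSn n) i) + U_(ord_max))%MM | i <- enum 'I_n].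

Lemma divisible_star mm : divisible star_monomials mm =
  (0 < mm ord_max)%N && [exists i : 'I_n, (0 < mm (widen_ord (leqnSn n) i))%N].
Proof.
rewrite /divisible has_map; apply/hasP/andP => [[i _ /mnm_lepP le_mm]|[pos /existsP[i pos_i]]].
  split; first by have := le_mm ord_max; rewrite mnmDE mnm1E mnm1E eqxx addn1; apply: leq_trans.
  apply/existsP; exists i; have := le_mm (widen_ord (leqnSn n) i).
  by rewrite mnmDE mnm1E eqxx; apply: leq_trans.
exists i; rewrite ?mem_enum //=; apply/mnm_lepP => k; rewrite mnmDE !mnm1E.
have ne : widen_ord (leqnSn n) i != ord_max.
  by apply/eqP => /(congr1 val) /= e; have := ltn_ord i; rewrite e ltnn.
case: eqP => [<-|_]; first by rewrite eq_sym (negbTE ne) addn0.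
by case: eqP => [<-|_].
Qed.

Lemma divisible_last_unit_max (mm : 'X_{1..n.+1}) :
  divisible (last_units n.+1 n) mm = (0 < mm ord_max)%N.
Proof.
rewrite divisible_last_units; apply/existsP/idP => [[i /andP[le_ni]]|pos].
  suff -> : i = ord_max by [].
  by apply/val_inj/eqP; rewrite /= eqn_leq le_ni -ltnS ltn_ord.
by exists ord_max; rewrite leqnn.
Qed.

(** A standard monomial of S_n / I_n either does not involve y or is a positive
    power of y; the latter contributes one monomial in each positive degree. *)
Lemma card_std_star e : #|std_monomials star_monomials e| =
  (#|std_monomials (last_units n.+1 n) e| + (0 < e))%N.
Proof.
case: (posnP e) => [->|e_gt0].
  rewrite addn0; apply: eq_card => mm; rewrite !inE divisible_star divisible_last_unit_max.
  case: eqP => //= /eqP; rewrite mdeg_eq0 => /eqP e0.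
  by rewrite e0 mnm0E.
pose ye : 'X_{1..n.+1} := (U_(ord_max) *+ e)%MM.
have deg_ye : mdeg ye = e by rewrite mdegMn mdeg1 mul1n.
have lt_ye : (mdeg ye < e.+1)%N by rewrite deg_ye.
have ye_max : ye ord_max = e by rewrite mulmnE mnm1E eqxx mul1n.
have ye_other i : i != ord_max -> ye i = 0%N.
  by rewrite mulmnE mnm1E eq_sym => /negbTE ->.
have ne_max (i : 'I_n) : widen_ord (leqnSn n) i != ord_max.
  by apply/eqP => /(congr1 val) /= ei; have := ltn_ord i; rewrite ei ltnn.
rewrite (cardsD1 (BMultinom lt_ye)) inE deg_ye eqxx divisible_star.
have -> : [exists i : 'I_n, (0 < ye (widen_ord (leqnSn n) i))%N] = false.
  by apply/existsP => -[i]; rewrite ye_other.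
rewrite andbF addnC; congr (_ + _)%N; apply: eq_card => mm; rewrite !inE.
rewrite divisible_star divisible_last_unit_max.
have [deg_mm|] := eqVneq (mdeg mm) e; last by rewrite andbF.
rewrite /=; case: (posnP ((mm : 'X_{1..n.+1}) ord_max)) => [mm0|mm_gt0] /=.
  rewrite andbT; apply/eqP => /(congr1 (fun b : 'X_{1..n.+1 < e.+1} => (b : 'X_{1..n.+1}) ord_max)).
  by rewrite /= mm0 ye_max => e0; rewrite -e0 in e_gt0.
apply/negbTE; rewrite negb_and !negbK; case: (boolP [exists _, _]) => [_|/existsPn no].
  by rewrite orbT.
rewrite orbF; apply/eqP/val_inj/mnmP => i /=.
have rest i' : i' != ord_max -> (mm : 'X_{1..n.+1}) i' = 0%N.
  move=> ne; have lt_i' : (i' < n)%N.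
    by rewrite ltn_neqAle -ltnS ltn_ord andbT; apply: contra ne => /eqP ei; apply/eqP/val_inj.
  have := no (Ordinal lt_i'); rewrite -eqn0Ngt => /eqP <-; congr (_ _).
  exact: val_inj.
have [->|ne] := eqVneq i ord_max; last by rewrite rest // ye_other.
by rewrite ye_max; apply: etrans deg_mm; rewrite mdegE (bigD1 ord_max) //= big1 ?addn0.
Qed.

End Star.

(** * A module of large depth *)

Section Realization.
Variables (K : fieldType) (m : nat).
Local Notation S := {mpoly K[m]}.

Lemma monomials_homog (gs : seq 'X_{1..m}) (p : S) :
  p \in monomials K gs -> exists e : nat, p \is e.-homog.
Proof. by case/mapP=> g _ ->; exists (mdeg g); rewrite dhomogX. Qed.

(** The polynomial ring in the first j variables (j <= m), as a quotient of S. *)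
Definition poly_module (j : nat) : gradedModule K m :=
  graded_cyclic_module (@monomials_homog (last_units m j)).

(** The quotient of S by the ideal generated by 1, the monomial of exponent 0. *)
Definition zero_module : gradedModule K m :=
  graded_cyclic_module (@monomials_homog [:: 0%MM]).

(** The graded module whose Hilbert series is the sum of the t^e/(1-t)^j, for
    (j, e) in L, as long as these j are at most m. *)
Fixpoint sum_module (L : seq (nat * nat)) : gradedModule K m :=
  if L is (j, e) :: L' then
    dsum_module (shift_module (poly_module j) e%:Z) (sum_module L')
  else zero_module.

Lemma zero_moduleE (u : zero_module) : u = 0.
Proof.
have [p ->] := cyclic_piP u; apply/cyclic_pi_eq0/idealP/in_ideal_monomialsP => mm.
by rewrite /divisible /= orbF => /negP[]; apply/mnm_lepP => i; rewrite mnm0E.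
Qed.

Lemma finitely_generated_sum L : finitely_generated (sum_module L).
Proof.
elim: L => [|[j e] L IH]; first exact: cyclic_module_fg.
by apply: finitely_generated_dsum => //; apply: cyclic_module_fg.
Qed.

Lemma has_dim_sum L d :
  has_dim (sum_module L) d (\sum_(p <- L) std_count (last_units m p.1) (d - p.2%:Z)).
Proof.
elim: L => [|[j e] L IH]; last first.
  by rewrite big_cons; apply: has_dim_dsum => //; apply/has_dim_shift/has_dim_monomials.
rewrite big_nil; exists (fun=> 0); split=> [i|u _|c _ []] //; first exact: gpart0.
by exists (fun=> 0); rewrite big_ord0; apply: zero_moduleE.
Qed.

Definition first_variables (r : nat) : seq 'I_m := [seq i : 'I_m <- enum 'I_m | (i < r)%N].

Lemma size_first_variables r : (r <= m)%N -> size (first_variables r) = r.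
Proof.
move=> le_rm; rewrite size_filter -(count_map val (fun i => i < r)%N) val_enum_ord.
have -> : iota 0 m = iota 0 r ++ iota r (m - r) by rewrite -{2}[r]add0n -iotaD subnKC.
rewrite count_cat -[RHS]addn0; congr (_ + _)%N.
  rewrite -[RHS](size_iota 0); apply/eqP; rewrite -all_count; apply/allP => i.
  by rewrite mem_iota.
apply/eqP; rewrite -leqn0 leqNgt -has_count; apply/hasPn => i.
by rewrite mem_iota -leqNgt => /andP[].
Qed.

Lemma weakly_regular_sum r L : all (fun p => r <= p.1)%N L ->
  weakly_regular (sum_module L) (variables K (first_variables r)).
Proof.
elim: L => [|[j e] L IH].
  move=> _ i _ u _; rewrite (zero_moduleE u); exact: in_idealM0.
move=> /= /andP[le_rj allL].
apply: (@weakly_regular_dsum _ _ (shift_module (poly_module j) e) (sum_module L)); last exact: IH.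
apply: weakly_regular_variables; rewrite cat_uniq; apply/and3P.
split; try by rewrite filter_uniq ?enum_uniq.
apply/hasPn => i; rewrite !mem_filter => /andP[le_ji _].
by rewrite negb_and -leqNgt (leq_trans le_rj).
Qed.

Lemma variables_in_maximal_ideal (l : seq 'I_m) p :
  p \in variables K l -> in_maximal_ideal p.
Proof.
case/mapP=> g /mapP[i _ ->] ->; apply: in_ideal_gen.
by apply/mapP; exists i; rewrite ?mem_enum.
Qed.

(** A variable of index below r does not vanish in any summand, since r <= j;
    hence it acts on each of them as a variable of a polynomial ring. *)
Lemma regular_seq_sum r L : L != [::] -> all (fun p => r <= p.1)%N L ->
  regular_seq (sum_module L) (variables K (first_variables r)).
Proof.
move=> nzL allL; split; first exact: variables_in_maximal_ideal.
  exact: weakly_regular_sum.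
case: L nzL {allL} => // -[j e] L _.
exists ((cyclic_pi (monomials K (last_units m j)) 1, 0) : sum_module ((j, e) :: L)).
by case/in_idealM_dsum => /variables_proper.
Qed.

End Realization.

Lemma ex_max_bounded (P : nat -> Prop) r b : P r -> (forall k, P k -> (k <= b)%N) ->
  exists h, [/\ P h, forall k, P k -> (k <= h)%N & (r <= h)%N].
Proof.
move=> Pr le_b.
have ex : exists k, `[< P k >] by exists r; apply/asboolP.
have bound k : `[< P k >] -> (k <= b)%N by move/asboolP; apply: le_b.
case: (ex_maxnP ex bound) => h /asboolP Ph max_h; exists h; split=> // [k Pk|].
  by apply: max_h; apply/asboolP.
by apply: max_h; apply/asboolP.
Qed.

(** The lengths of the regular sequences on any module are bounded by the number
    of variables ([regular_seq_size_le]).  So N has a depth, and among the depths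
    of the modules with the Hilbert series of M there is a largest one. *)
Lemma is_hdepth_ge (K : fieldType) (m : nat) (M N : gradedModule K m) s :
  hdepth_candidate M N -> regular_seq N s ->
  exists2 h, is_hdepth M h & (size s <= h)%N.
Proof.
move=> cand reg_s.
have [||k [[t reg_t size_t] k_max le_k]] :=
    @ex_max_bounded (fun k => exists2 t, regular_seq N t & size t = k) (size s) m.
- by exists s.
- by move=> k [t reg_t <-]; apply: regular_seq_size_le reg_t.
have depth_k : is_depth N k.
  by split=> [|u reg_u]; [exists t|apply: k_max; exists u].
have [||h [ex_h h_max le_h]] := @ex_max_bounded
    (fun k => exists2 N', hdepth_candidate M N' & is_depth N' k) k m.
- by exists N.
- by move=> k' [N' _ [[t' reg_t' <-] _]]; apply: regular_seq_size_le reg_t'.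
exists h; last exact: leq_trans le_h.
by split=> // N' k' cand' depth'; apply: h_max; exists N'.
Qed.

Section StarModule.
Variables (K : fieldType) (n : nat).

Lemma star_edges_monomials : star_edges K n = monomials K (star_monomials n).
Proof. by rewrite /monomials -map_comp; apply: eq_map => i /=; rewrite mpolyXD. Qed.

Lemma has_dim_cyclic m (s : seq {mpoly K[m]}) gs
    (hs : forall p, p \in s -> exists e : nat, p \is e.-homog) d :
  s = monomials K gs -> has_dim (graded_cyclic_module hs) d (std_count gs d).
Proof. by move=> es; subst s; apply: has_dim_monomials. Qed.

Lemma star_hilbert_series :
  is_hilbert_series (star_module K n) (std_count (star_monomials n)).
Proof. by move=> d; apply: has_dim_cyclic; apply: star_edges_monomials. Qed.

Lemma star_module_neq0 : exists u : star_module K n, u <> 0.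
Proof.
exists (cyclic_pi _ 1) => /cyclic_pi_eq0/idealP.
rewrite star_edges_monomials => /in_ideal_monomialsP/(_ 0%MM).
rewrite divisible_star mnm0E mcoeff1 eqxx => /(_ isT) /eqP.
by rewrite oner_eq0.
Qed.

Lemma std_count_star (d : nat) : (0 < n)%N ->
  (std_count (star_monomials n) d)%:Z = iter n psum (delta 0) d + psum (delta 1) d.
Proof.
move=> n_gt0; rewrite /= card_std_star PoszD psum_delta; congr (_ + _); last by case: d.
by have := @std_count_last_units n.+1 n 0 d; rewrite subr0 n_gt0 leqnSn => <-.
Qed.

(** The inequalities between binomial coefficients say that (1-t)^r H has
    nonnegative coefficients. *)
Lemma star_candidate r : (0 < r < n)%N ->
  (forall j, odd j -> 'C(r.-1, j) <= 'C(n - r.+1 + j.+1, j.+1))%N ->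
  exists (N : gradedModule K n.+1) s,
    [/\ hdepth_candidate (star_module K n) N, regular_seq N s & size s = r].
Proof.
move=> hr hle; have n_gt0 : (0 < n)%N by case/andP: hr => _; apply: leq_trans.
have [L allL eL] := decomposable_star hr hle.
have le_rL : all (fun p => r <= p.1)%N L by apply: sub_all allL => p /andP[].
exists (sum_module K n.+1 L), (variables K (first_variables n.+1 r)); split.
- split; first exact: finitely_generated_sum.
  exists (std_count (star_monomials n)); split; first exact: star_hilbert_series.
  move=> d; suff -> : std_count (star_monomials n) d =
    (\sum_(p <- L) std_count (last_units n.+1 p.1) (d - p.2%:Z))%N by apply: has_dim_sum.
  case: d => [d|d]; last first.
    rewrite big1 // => p _; rewrite std_count_lt0 //.
    by rewrite NegzE; lia.
  apply/eqP; rewrite -eqz_nat std_count_star // eL.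
  rewrite (big_morph Posz PoszD (erefl 0%:Z)); apply/eqP; apply: eq_big_seq => -[j e] Lje /=.
  move/allP: allL => /(_ _ Lje) /= /andP[le_rj le_jn].
  by rewrite std_count_last_units //; lia.
- apply: regular_seq_sum => //; apply/eqP => L0.
  have := eL 0%N; rewrite L0 big_nil -std_count_star //= card_std_star.
  by rewrite card_std_monomials ?n_gt0 ?leqnSn //= !addn0 binn.
by rewrite !size_map size_first_variables //; lia.
Qed.

End StarModule.

Lemma ceil_half_le (n : nat) : Num.ceil (n%:R / 2%:R : algC) <= (uphalf n)%:Z.
Proof.
rewrite real_ceil_le_int ?realM ?realV ?realn // ler_pdivrMr ?ltr0n //.
rewrite -natrM ler_nat; lia.
Qed.

Lemma floor_sqrt_sq (n : nat) : exists2 s : nat,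
  Num.floor (sqrtC (n%:R : algC)) = s%:Z & (s * s <= n)%N.
Proof.
have sq_ge0 : 0 <= sqrtC (n%:R : algC) by rewrite sqrtC_ge0 ler0n.
have sq_real := ger0_real sq_ge0.
have fl_ge0 : 0 <= Num.floor (sqrtC (n%:R : algC)) by rewrite real_floor_ge0.
exists `|Num.floor (sqrtC (n%:R : algC))|%N; first by rewrite gez0_abs.
set s := `|_|%N; have le_s : s%:R <= sqrtC (n%:R : algC).
  by have := real_floor_le sq_real; rewrite -{1}(gez0_abs fl_ge0).
rewrite -(ler_nat algC) natrM -[leRHS]sqrtCK expr2.
by apply: ler_pM.
Qed.

Theorem theorem2p5 (K : fieldType) (n : nat) (hn : (1 <= n)%N) :
  exists2 h : nat, is_hdepth (star_module K n) h &
    Num.ceil (n%:R / 2%:R : algC) + Num.floor (sqrtC (n%:R : algC)) - 2%:Z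
      <= h%:Z.
Proof.
have [s -> le_sn] := floor_sqrt_sq n; have le_ceil := ceil_half_le n.
pose r := (uphalf n + s - 2)%N.
suff [N [t [cand reg_t size_t]]] : exists (N : gradedModule K n.+1) t,
    [/\ hdepth_candidate (star_module K n) N, regular_seq N t & size t = r].
  have [h hdepth_h le_h] := is_hdepth_ge cand reg_t; exists h => //.
  move: le_h le_ceil; rewrite size_t /r; move: (Num.ceil _) => c; lia.
case: (posnP r) => [r0|r_gt0].
  (* the empty sequence is regular on the nonzero module S_n / I_n *)
  exists (star_module K n), [::]; split=> //; last first.
    split=> //; have [u nu] := star_module_neq0 K n.
    by exists u => -[v]; rewrite big_ord0.
  split; first exact: cyclic_module_fg.
  by exists (std_count (star_monomials n)); split; apply: star_hilbert_series.
have [lt_rn le_binom] := star_binom_le le_sn erefl r_gt0.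
by apply: star_candidate; rewrite ?r_gt0.
Qed.
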